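(* Let $\mathbf P=(P,\le,0,1)$ be a bounded poset with $0\neq 1$, and let $A,B\in D(\mathbf P)$. Then the following are equivalent: (i) $A\perp_{\mathbf D(\mathbf P)}B$, i.e. $LU(A\cup B)=P$ and $A\cap B=\{0\}$; (ii) the supremum $\bigvee_{\mathbf P}(A\cup B)$ exists in $\mathbf P$ and equals $1$, and for all $x\in A$ and all $y\in B$ the infimum $x\wedge y$ exists in $\mathbf P$ and equals $0$.
   Context: For $X\subseteq P$ let $U(X)=\{z\in P\mid x\le z\text{ for all }x\in X\}$, $L(X)=\{z\in P\mid z\le x\text{ for all }x\in X\}$, and $LU(X)=L(U(X))$. The Dedekind–MacNeille completion is $\mathbf D(\mathbf P)=(D(\mathbf P),\subseteq)$ where $D(\mathbf P)=\{L(X)\mid X\subseteq P\}=\{X\subseteq P\mid LU(X)=X\}$; it is a complete lattice with joins $\bigvee_i A_i=LU(\bigcup_i A_i)$ and meets $\bigwedge_i A_i=\bigcap_i A_i$, least element $L(0)=\{0\}$ and greatest element $L(1)=P$. In a bounded lattice or poset, two elements $a,b$ are orthogonal ($a\perp b$) if $a\vee b$ exists and equals the greatest element and $a\wedge b$ exists and equals the least element; so $A\perp_{\mathbf D(\mathbf P)}B$ means $A\vee B=P$ and $A\wedge B=\{0\}$ in $\mathbf D(\mathbf P)$. *)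

(* Defs.v *)
From HB Require Import structures.
From mathcomp Require Import all_boot all_order.
From mathcomp Require Import boolp classical_sets.

Set Implicit Arguments.
Unset Strict Implicit.
Unset Printing Implicit Defensive.

Import Order.Theory.
Local Open Scope order_scope.
Local Open Scope classical_set_scope.

(* [supremums X] and [infimums X] are the sets of least upper and greatest
   lower bounds of [X]; they contain at most one element, so membership of [x]
   says that the bound exists and equals [x]. *)
Definition orthogonal (d : Order.disp_t) (T : tbPOrderType d) (a b : T) : Prop :=
  supremums [set a; b] \top /\ infimums [set a; b] \bot.

(* [ubound] is U, [lbound] is L, and [completion P] is the Dedekind-MacNeille
   completion D(P): the sets of the form L(X), ordered by inclusion. *)
Definition is_cut (d : Order.disp_t) (P : porderType d) (A : set P) : bool :=
  `[< exists X : set P, A = lbound X >].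

Record completion (d : Order.disp_t) (P : porderType d) :=
  Completion { cut :> set P; cutP : is_cut cut }.

Section CompletionOrder.
Context {d : Order.disp_t}.

(* [set_display] is the inclusion order on sets. *)
HB.instance Definition _ (P : porderType d) := [isSub for @cut d P].
HB.instance Definition _ (P : porderType d) :=
  [Choice of completion P by <:].
HB.instance Definition _ (P : porderType d) :=
  [SubChoice_isSubPOrder of completion P by <: with set_display].

Lemma completion_leP (P : porderType d) (A B : completion P) :
  reflect (cut A `<=` cut B) (A <= B).
Proof. exact: asboolP. Qed.

Lemma is_cut_bot (P : tbPOrderType d) : is_cut [set (\bot : P)].
Proof.
apply/asboolP; exists [set: P]; apply/seteqP; split => [_ -> y _|x lx].
  exact: le0x.
by apply/eqP; rewrite eq_le le0x andbT; apply: lx.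
Qed.

Lemma is_cut_top (P : tbPOrderType d) : is_cut [set: P].
Proof.
by apply/asboolP; exists [set \top]; apply/seteqP; split => // x _ _ ->; apply: lex1.
Qed.

Lemma completion_le0x (P : tbPOrderType d) (A : completion P) :
  Completion (is_cut_bot P) <= A.
Proof.
apply/completion_leP => _ -> /=.
by have /asboolP[X ->] := cutP A; move=> y _; apply: le0x.
Qed.

Lemma completion_lex1 (P : tbPOrderType d) (A : completion P) :
  A <= Completion (is_cut_top P).
Proof. exact/completion_leP. Qed.

HB.instance Definition _ (P : tbPOrderType d) :=
  Order.hasBottom.Build set_display (completion P) (@completion_le0x P).
HB.instance Definition _ (P : tbPOrderType d) :=
  Order.hasTop.Build set_display (completion P) (@completion_lex1 P).

End CompletionOrder.

(* Main.v *)
(* Joins and meets of two cuts in the completion are [LU(A `|` B)] and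
   [A `&` B]. That [LU(S)] is everything means that the only upper bound of [S]
   is [\top]. Cuts are down-closed, so common lower bounds of [x \in A] and
   [y \in B] lie in [A `&` B]; conversely [z \in A `&` B] is the infimum of the
   pair [z, z]. *)
Require Import Defs.
From mathcomp Require Import all_boot all_order.
From mathcomp Require Import boolp classical_sets.

Import Order.Theory.
Local Open Scope order_scope.
Local Open Scope classical_set_scope.

Lemma is_cut_lbound (d : Order.disp_t) (P : porderType d) (X : set P) :
  is_cut (lbound X).
Proof. by apply/asboolP; exists X. Qed.

(** Taking lower bounds turns unions into intersections, so the union of the two generating sets is
    the witness. *)
Lemma is_cutI (d : Order.disp_t) (P : porderType d) (A B : set P) :
  is_cut A -> is_cut B -> is_cut (A `&` B).
Proof.
move=> /asboolP[X ->] /asboolP[Y ->]; apply/asboolP; exists (X `|` Y).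
apply/seteqP; split=> [x [lX lY] y [/lX|/lY]|x lXY] //.
by split=> y ?; apply: lXY; [left|right].
Qed.

Lemma cut_le (d : Order.disp_t) (P : porderType d) (A : completion P) (x y : P) :
  x <= y -> cut A y -> cut A x.
Proof.
by have /asboolP[X ->] := cutP A => lexy lby z /lby; apply: le_trans.
Qed.

Lemma cut0 (d : Order.disp_t) (P : tbPOrderType d) (A : completion P) :
  cut A \bot.
Proof. by have /asboolP[X ->] := cutP A => y _; apply: le0x. Qed.

(** Minimality of LU: if [A] is L(X) and contains [S], every element of [X] is an upper bound of
    [S], hence lies above all of LU(S). *)
Lemma sub_cut_LU (d : Order.disp_t) (P : porderType d) (S : set P)
    (A : completion P) :
  S `<=` cut A -> lbound (ubound S) `<=` cut A.
Proof.
have /asboolP[X ->] := cutP A => SX x luSx y Xy.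
by apply: luSx => z /SX; apply.
Qed.

Lemma supremums_completion (d : Order.disp_t) (P : porderType d)
    (A B C : completion P) :
  supremums [set A; B] C <-> cut C = lbound (ubound (cut A `|` cut B)).
Proof.
have sub_LU (S : set P) : S `<=` lbound (ubound S) by move=> x Sx y; apply.
split=> [[ubC lubC]|defC].
  apply/seteqP; split.
    (* [J] is an upper bound of the pair in the completion, so the least one, [C], lies below it. *)
    pose J := Completion (is_cut_lbound _ _ (ubound (cut A `|` cut B))).
    apply: (elimT (completion_leP C J)); apply: lubC => _ [->|->].
      by apply/completion_leP => x Ax; apply: sub_LU; left.
    by apply/completion_leP => x Bx; apply: sub_LU; right.
  apply: sub_cut_LU => x [].
    by apply/completion_leP; apply: ubC; left.
  by apply/completion_leP; apply: ubC; right.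
split=> [_ [->|->]|D ubD]; apply/completion_leP.
- by rewrite defC => x Ax; apply: sub_LU; left.
- by rewrite defC => x Bx; apply: sub_LU; right.
rewrite defC; apply: sub_cut_LU => x [].
  by apply/completion_leP; apply: ubD; left.
by apply/completion_leP; apply: ubD; right.
Qed.

Lemma infimums_completion (d : Order.disp_t) (P : porderType d)
    (A B C : completion P) :
  infimums [set A; B] C <-> cut C = cut A `&` cut B.
Proof.
split=> [[lbC glbC]|defC].
  apply/seteqP; split=> [x Cx|].
    (* Generalizing [x] again turns each membership into an inclusion, that is, into [C <= A] or
       [C <= B]. *)
    split; move: x Cx; apply/completion_leP; apply: lbC; first by left.
    by right.
  pose M := Completion (is_cutI _ _ _ _ (cutP A) (cutP B)).
  apply: (elimT (completion_leP M C)); apply: glbC => _ [->|->].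
    by apply/completion_leP => x [].
  by apply/completion_leP => x [].
split=> [_ [->|->]|D lbD]; apply/completion_leP.
- by rewrite defC => x [].
- by rewrite defC => x [].
rewrite defC => x Dx; split; move: x Dx; apply/completion_leP; apply: lbD.
  by left.
by right.
Qed.

Lemma LU_eqT (d : Order.disp_t) (P : tbPOrderType d) (S : set P) :
  lbound (ubound S) = [set: P] <-> supremums S \top.
Proof.
split=> [LUT|[_ lub1]].
  split; first by move=> x _; apply: lex1.
  (* That [\top] lies in LU(S) is exactly the leastness half of [supremums S \top]. *)
  by have : [set: P] \top by []; rewrite -LUT.
apply/seteqP; split=> // x _ y /lub1; apply: le_trans; exact: lex1.
Qed.

Lemma cutI_eq0 (d : Order.disp_t) (P : tbPOrderType d) (A B : completion P) :
  cut A `&` cut B = [set \bot] <->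
  forall x y : P, cut A x -> cut B y -> infimums [set x; y] \bot.
Proof.
split=> [AB0 x y Ax By|inf0].
  split=> [z _|z lbz]; first exact: le0x.
  have : (cut A `&` cut B) z.
    by split; [apply: cut_le Ax|apply: cut_le By]; apply: lbz; [left|right].
  by rewrite AB0 => ->.
apply/seteqP; split=> [z [Az Bz]|_ ->]; last by split; apply: cut0.
have [_ glb0] := inf0 z z Az Bz.
by apply/eqP; rewrite -lex0; apply: glb0 => _ [->|->].
Qed.

Theorem theorem5p1 (d : Order.disp_t) (P : tbPOrderType d)
    (nontrivial : (\bot : P) <> \top) (A B : completion P) :
  (orthogonal A B <->
     lbound (ubound (cut A `|` cut B)) = [set: P] /\
     cut A `&` cut B = [set \bot])
  /\
  (orthogonal A B <->
     supremums (cut A `|` cut B) \top /\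
     forall x y : P, cut A x -> cut B y -> infimums [set x; y] \bot).
Proof.
have orthE : orthogonal A B <->
    lbound (ubound (cut A `|` cut B)) = [set: P] /\ cut A `&` cut B = [set \bot].
  rewrite /orthogonal supremums_completion infimums_completion.
  (* The cuts underlying [\top] and [\bot] of the completion are [[set: P]] and [[set \bot]] by
     computation, so it remains only to swap the sides of the equations. *)
  by split=> -[joinE meetE]; split; symmetry.
by split=> //; rewrite orthE LU_eqT cutI_eq0.
Qed.
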